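(* Let $r$ be an even integer, $n$ a positive integer and $m$ a non-negative integer, and let $\alpha=(1+\sqrt5)/2$. Then \[ \begin{split} \frac{( - 1)^n }{n}\sum_{j = m}^\infty \frac{F_{r(n + j)}}{L_r^{n + j} \binom{n + j}j} &= \sum_{j = 1}^{n - 1} \binom{n - 1}j\frac{( - 1)^j F_{r(n - j - 1)}}{jL_r^{n - j - 1} \binom{m + j}j} - \sum_{j = 1}^m \binom mj\frac{( - 1)^j F_{r(n + j - 1)}}{jL_r^{n + j - 1} \binom{n - 1 + j}j}\\ &\qquad+ \frac{F_{r(n - 1)}}{L_r^{n - 1}}\sum_{j = m + 1}^{n - 1} \frac{1}{j} + \frac{1}{L_r^{n - 1}}\left( F_{r(n - 1)} \log L_r - \frac{rL_{r(n - 1)}}{\sqrt 5 }\log \alpha \right), \end{split} \] and \[ \begin{split} \frac{( - 1)^{n - 1} }{n}\sum_{j = m}^\infty \frac{L_{r(n + j)}}{L_r^{n + j} \binom{n + j}j} &= \sum_{j = 1}^{n - 1} \binom{n - 1}j\frac{( - 1)^j L_{r(n - j - 1)}}{jL_r^{n - j - 1} \binom{m + j}j} - \sum_{j = 1}^m \binom mj\frac{( - 1)^j L_{r(n + j - 1)}}{jL_r^{n + j - 1} \binom{n - 1 + j}j}\\ &\qquad+ \frac{L_{r(n - 1)}}{L_r^{n - 1}}\sum_{j = m + 1}^{n - 1} \frac{1}{j} + \frac{1}{L_r^{n - 1}}\left( L_{r(n - 1)} \log L_r - rF_{r(n - 1)}\sqrt 5 \log \alpha \right). \end{split} \]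
   Context: $F_j$ and $L_j$ denote the Fibonacci and Lucas numbers, defined for all integers $j$ by $F_0=0$, $F_1=1$, $L_0=2$, $L_1=1$, $F_j=F_{j-1}+F_{j-2}$, $L_j=L_{j-1}+L_{j-2}$, extended to negative indices by $F_{-j}=(-1)^{j-1}F_j$, $L_{-j}=(-1)^jL_j$; equivalently $F_j=(\alpha^j-\beta^j)/\sqrt5$, $L_j=\alpha^j+\beta^j$ with $\beta=(1-\sqrt5)/2$. $\log$ is the natural logarithm. Sums $\sum_{j=1}^{0}$ are zero, and $\sum_{j=m+1}^{n-1}\frac1j$ denotes $H_{n-1}-H_m$ where $H_k=\sum_{i=1}^k\frac1i$ (so it is the ordinary sum when $m\le n-1$ and equals $-\sum_{j=n}^{m}\frac1j$ when $m\ge n$). *)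

(* Defs.v *)
From Stdlib Require Import Reals ZArith.
From Coquelicot Require Import Coquelicot.

Fixpoint fib_nat (n : nat) : Z :=
  match n with
  | 0%nat => 0%Z
  | S p => match p with
           | 0%nat => 1%Z
           | S q => (fib_nat p + fib_nat q)%Z
           end
  end.

Fixpoint lucas_nat (n : nat) : Z :=
  match n with
  | 0%nat => 2%Z
  | S p => match p with
           | 0%nat => 1%Z
           | S q => (lucas_nat p + lucas_nat q)%Z
           end
  end.

Definition fib (j : Z) : Z :=
  if (0 <=? j)%Z then fib_nat (Z.to_nat j)
  else ((-1) ^ (- j - 1) * fib_nat (Z.to_nat (- j)))%Z.

Definition lucas (j : Z) : Z :=
  if (0 <=? j)%Z then lucas_nat (Z.to_nat j)
  else ((-1) ^ (- j) * lucas_nat (Z.to_nat (- j)))%Z.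

Definition F (j : Z) : R := IZR (fib j).
Definition L (j : Z) : R := IZR (lucas j).

(* The name [C] alone denotes Coquelicot's complex numbers.  The quotient of
   factorials [Binomial.C n k] is the binomial coefficient only for k <= n. *)
Definition binom (n k : nat) : R := Binomial.C n k.

(* [sum_n_m a 1 k] is zero when k = 0. *)
Definition H (k : nat) : R := sum_n_m (fun i => / INR i)%R 1 k.

Definition golden : R := ((1 + sqrt 5) / 2)%R.

(* Main.v *)
(** Put [x = alpha^r / L_r] and [y = alpha^(-r) / L_r].  For even [r] Binet's
    formulas give [x + y = 1] and express [F_{rk} / L_r^k] and [L_{rk} / L_r^k]
    as combinations of [x^k] and [y^k], so both identities are linear
    combinations of one evaluation of
    [1/n * sum_{j >= m} z^(n+j) / binom(n+j, j)] in terms of [w = 1 - z], at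
    [z = x] and [z = y].  As [1 / (n binom(n+j, j))] is the Beta value
    [B(n, j+1)], the relation [B(n, j+1) = B(n, j+2) + B(n+1, j+1)] gives a
    recurrence in [n] at [m = 0], starting from the series of [- ln (1 - z)];
    the dependence on [m] is removal of one term at a time.  On the closed form
    either step is the binomial theorem. *)

Require Import Defs.
From Stdlib Require Import Reals ZArith Lra Lia.
From Coquelicot Require Import Coquelicot.
Open Scope R_scope.

(* Coquelicot's generic lemmas state equalities in the carrier of an algebraic
   structure on [R], which [ring] and [field] do not recognise. *)
Ltac eq_in_R := match goal with |- ?a = ?b => change (@eq R a b) end.

(** * Binomial coefficients as factorial quotients, signs and finite sums *)

Lemma binom_fact_r (n k : nat) :
  binom (n + k) k = INR (fact (n + k)) / (INR (fact k) * INR (fact n)).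
Proof.
  unfold binom, Binomial.C. now replace (n + k - k)%nat with n by lia.
Qed.

Lemma binom_fact_l (n k : nat) :
  binom (n + k) n = INR (fact (n + k)) / (INR (fact n) * INR (fact k)).
Proof. rewrite Nat.add_comm, binom_fact_r. reflexivity. Qed.

Lemma INR_fact_S (n : nat) : INR (fact (S n)) = (INR n + 1) * INR (fact n).
Proof. now rewrite fact_simpl, mult_INR, S_INR. Qed.

Lemma binom_diag (k : nat) : binom k k = 1.
Proof.
  unfold binom, Binomial.C. rewrite Nat.sub_diag.
  simpl (fact 0). simpl (INR 1). field. apply INR_fact_neq_0.
Qed.

Lemma binom_0_r (k : nat) : binom k 0 = 1.
Proof.
  unfold binom, Binomial.C. rewrite Nat.sub_0_r.
  simpl (fact 0). simpl (INR 1). field. apply INR_fact_neq_0.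
Qed.

Lemma pow_m1_square (n : nat) : (-1) ^ n * (-1) ^ n = 1.
Proof.
  rewrite <- Rpow_mult_distr. replace (-1 * -1) with 1 by ring. apply pow1.
Qed.

Lemma pow_opp (x : R) (n : nat) : (- x) ^ n = (-1) ^ n * x ^ n.
Proof. rewrite <- Rpow_mult_distr. f_equal. ring. Qed.

Lemma sum_n_m_lin (a b : R) (u v : nat -> R) (n m : nat) :
  sum_n_m (fun k => a * u k + b * v k) n m
  = a * sum_n_m u n m + b * sum_n_m v n m.
Proof.
  rewrite <- (sum_n_m_mult_l (K := R_Ring) a u), <- (sum_n_m_mult_l (K := R_Ring) b v).
  now rewrite <- (sum_n_m_plus (G := R_AbelianMonoid)).
Qed.

Lemma sum_n_m_last (u : nat -> R) (n : nat) :
  sum_n_m u 1 (S n) = sum_n_m u 1 n + u (S n).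
Proof. apply (sum_n_Sm u). lia. Qed.

Lemma sum_n_m_empty (u : nat -> R) : sum_n_m u 1 0 = 0.
Proof. apply (sum_n_m_zero u). lia. Qed.

(** Cuts a binomial expansion at the index [p] in the shape of [beta_closed]: the part below [p],
    indexed by distance from [p], faces the first sum, the central term faces the harmonic
    difference, and the part above [p] faces the second sum. *)
Lemma sum_f_R0_around (f : nat -> R) (p q : nat) :
  sum_f_R0 f (p + q)
  = sum_n_m (fun j => f (p - j)%nat) 1 p + f p + sum_n_m (fun j => f (p + j)%nat) 1 q.
Proof.
  induction q as [|q IHq].
  - rewrite Nat.add_0_r, (sum_n_m_empty (fun j => f (p + j)%nat)).
    induction p as [|p IHp].
    + rewrite sum_n_m_empty. simpl. ring.
    + rewrite tech5, IHp, <- (sum_n_m_S (fun j => f (S p - j)%nat)).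
      rewrite (sum_Sn_m (fun j => f (S p - S j)%nat) 0 p) by lia.
      change plus with Rplus. simpl. rewrite Nat.sub_0_r. ring.
  - rewrite Nat.add_succ_r, tech5, IHq, sum_n_m_last, Nat.add_succ_r. ring.
Qed.

(** * Beta values, the closed form and its recurrences *)

(* [beta_coef p j] is the Beta value [B(p + 1, j + 1)]; [p] stands for [n - 1]. *)
Definition beta_coef (p j : nat) : R :=
  INR (fact p) * INR (fact j) / INR (fact (p + 1 + j)).

Lemma beta_coef_binom (p j : nat) :
  beta_coef p j = / (INR (S p) * binom (S p + j) j).
Proof.
  unfold beta_coef. rewrite binom_fact_r.
  replace (p + 1 + j)%nat with (S p + j)%nat by lia.
  rewrite INR_fact_S, S_INR.
  pose proof (INR_fact_neq_0 j). pose proof (INR_fact_neq_0 p).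
  pose proof (INR_fact_neq_0 (S p + j)). pose proof (pos_INR p).
  field. repeat split; try assumption; lra.
Qed.

(** In terms of the integral of t^p (1 - t)^j over [0, 1], this is t = 1 - (1 - t) inserted into the
    integrand. *)
Lemma beta_coef_S_l (p j : nat) :
  beta_coef (S p) j = beta_coef p j - beta_coef p (S j).
Proof.
  unfold beta_coef.
  replace (S p + 1 + j)%nat with (S (p + 1 + j)) by lia.
  replace (p + 1 + S j)%nat with (S (p + 1 + j)) by lia.
  rewrite !INR_fact_S, !plus_INR. simpl (INR 1).
  pose proof (INR_fact_neq_0 (p + 1 + j)). pose proof (pos_INR p). pose proof (pos_INR j).
  field. repeat split; try assumption; lra.
Qed.

Lemma beta_coef_0_r (p : nat) : beta_coef p 0 = / INR (S p).
Proof.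
  unfold beta_coef. replace (p + 1 + 0)%nat with (S p) by lia.
  rewrite INR_fact_S, S_INR. pose proof (INR_fact_neq_0 p). pose proof (pos_INR p).
  simpl (fact 0). simpl (INR 1). field. repeat split; try assumption; lra.
Qed.

(** The common shape of both right-hand sides for n = p + 1, with w^k in place of F_{rk} / L_r^k or
    L_{rk} / L_r^k. At w = 1 - z it is, up to the sign (-1)^p, the sum of the series with terms
    [beta_coef p j * z ^ (p + 1 + j)] over j >= m. *)
Definition beta_closed (p m : nat) (w : R) : R :=
  sum_n_m (fun j => binom p j * ((-1) ^ j * w ^ (p - j) / (INR j * binom (m + j) j))) 1 p
  - sum_n_m (fun j => binom m j * ((-1) ^ j * w ^ (p + j) / (INR j * binom (p + j) j))) 1 m
  + w ^ p * (H p - H m) - w ^ p * ln w.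

Lemma H_S (n : nat) : H (S n) = H n + / INR (S n).
Proof. apply sum_n_m_last. Qed.

Lemma H_0 : H 0 = 0.
Proof. apply sum_n_m_empty. Qed.

(** Passing from [m] to [S m] changes the lower sum, the upper sum and the harmonic difference.
    After multiplication by [c], the pieces of the expansion of (1 - w)^(p + m + 1) below, above and
    at the index [p] are exactly these three changes. *)
Lemma beta_closed_S_r (p m : nat) (w : R) :
  beta_closed p (S m) w - beta_closed p m w
  = - ((-1) ^ p * beta_coef p m * (1 - w) ^ (p + S m)).
Proof.
  replace (1 - w) with (- w + 1) by ring.
  rewrite binomial.
  set (c := (-1) ^ p * beta_coef p m).
  set (f := fun i : nat => Binomial.C (p + S m) i * (- w) ^ i * 1 ^ (p + S m - i)).
  rewrite sum_f_R0_around.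
  assert (Hlow : sum_n_m (fun j => binom p j
              * ((-1) ^ j * w ^ (p - j) / (INR j * binom (S m + j) j))) 1 p
      = sum_n_m (fun j => binom p j
              * ((-1) ^ j * w ^ (p - j) / (INR j * binom (m + j) j))) 1 p
        - c * sum_n_m (fun j => f (p - j)%nat) 1 p).
  { match goal with |- _ = ?X - _ * ?Y =>
      replace (X - c * Y) with (1 * X + - c * Y) by ring end.
    rewrite <- sum_n_m_lin. apply sum_n_m_ext_loc. intros j Hj.
    eq_in_R.
    (* Writing p = q + j removes truncated subtraction, so every coefficient becomes a quotient of
       factorials. *)
    destruct (Nat.le_exists_sub j p) as [q [-> _]]; [lia|].
    unfold c, f, beta_coef. fold (binom (q + j + S m) (q + j - j)).
    replace (q + j - j)%nat with q by lia.
    replace (q + j + S m)%nat with (q + S (m + j))%nat by lia.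
    replace (q + j + 1 + m)%nat with (q + S (m + j))%nat by lia.
    change (S m + j)%nat with (S (m + j)).
    rewrite binom_fact_l, !binom_fact_r, pow1, pow_opp, pow_add.
    change (S (m + j)) with (S m + j)%nat. rewrite (binom_fact_r (S m) j).
    change (S m + j)%nat with (S (m + j)). rewrite !INR_fact_S, plus_INR.
    assert (INR j <> 0) by (apply not_0_INR; lia).
    pose proof (pos_INR m). pose proof (pos_INR j).
    pose proof (INR_fact_neq_0 q). pose proof (INR_fact_neq_0 j).
    pose proof (INR_fact_neq_0 m). pose proof (INR_fact_neq_0 (m + j)).
    pose proof (INR_fact_neq_0 (q + S (m + j))). pose proof (INR_fact_neq_0 (q + j)).
    (* The factor [c] contributes (-1)^(q + j) and [(- w) ^ q] contributes (-1)^q. The repeated [s]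
       squares to 1, a fact [field] does not know, and the sign (-1)^j of the lower sum remains. *)
    set (A := (-1) ^ j).
    set (s := (-1) ^ q). assert (Hs : s * s = 1) by apply pow_m1_square.
    match goal with |- _ = ?X + - (s * A * ?Y) * (?Z * (s * ?W) * 1) =>
      replace (X + - (s * A * Y) * (Z * (s * W) * 1))
        with (X - (s * s) * (A * Y * Z * W)) by ring end.
    rewrite Hs. field. repeat split; try assumption; lra. }
  assert (Hhigh : sum_n_m (fun j => binom (S m) j
              * ((-1) ^ j * w ^ (p + j) / (INR j * binom (p + j) j))) 1 (S m)
      = sum_n_m (fun j => binom m j
              * ((-1) ^ j * w ^ (p + j) / (INR j * binom (p + j) j))) 1 m
        + c * sum_n_m (fun j => f (p + j)%nat) 1 (S m)).
  { rewrite !sum_n_m_last, Rmult_plus_distr_l, <- Rplus_assoc. f_equal.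
    - match goal with |- _ = ?X + _ * ?Y =>
        replace (X + c * Y) with (1 * X + c * Y) by ring end.
      rewrite <- sum_n_m_lin. apply sum_n_m_ext_loc. intros j Hj.
    eq_in_R.
      destruct (Nat.le_exists_sub j m) as [q [-> _]]; [lia|].
      unfold c, f, beta_coef. fold (binom (p + S (q + j)) (p + j)).
      change (S (q + j)) with (S q + j)%nat.
      replace (p + (S q + j))%nat with (p + j + S q)%nat by lia.
      replace (p + 1 + (q + j))%nat with (p + j + S q)%nat by lia.
      rewrite binom_fact_l, !binom_fact_r, pow1, pow_opp, (pow_add (-1)).
      change (S q + j)%nat with (S (q + j)). rewrite !INR_fact_S, plus_INR.
      assert (INR j <> 0) by (apply not_0_INR; lia).
      pose proof (pos_INR q). pose proof (pos_INR j).
      pose proof (INR_fact_neq_0 q). pose proof (INR_fact_neq_0 j).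
      pose proof (INR_fact_neq_0 p). pose proof (INR_fact_neq_0 (p + j)).
      pose proof (INR_fact_neq_0 (q + j)). pose proof (INR_fact_neq_0 (p + j + S q)).
      set (A := (-1) ^ j).
      set (s := (-1) ^ p). assert (Hs : s * s = 1) by apply pow_m1_square.
      match goal with |- _ = ?X + s * ?Y * (?Z * (s * A * ?W) * 1) =>
        replace (X + s * Y * (Z * (s * A * W) * 1))
          with (X + (s * s) * (Y * Z * A * W)) by ring end.
      rewrite Hs. field. repeat split; try assumption; lra.
    (* The term j = S m has no counterpart in the sum up to [m]; it must equal the top term of the
       expansion by itself. *)
    - unfold c, f, beta_coef. fold (binom (p + S m) (p + S m)).
      rewrite !binom_diag, binom_fact_r, pow1, pow_opp, (pow_add (-1)).
      replace (p + 1 + m)%nat with (p + S m)%nat by lia.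
      rewrite !INR_fact_S, S_INR.
      pose proof (pos_INR m). pose proof (INR_fact_neq_0 m).
      pose proof (INR_fact_neq_0 p). pose proof (INR_fact_neq_0 (p + S m)).
      set (A := (-1) ^ S m).
      set (s := (-1) ^ p). assert (Hs : s * s = 1) by apply pow_m1_square.
      match goal with |- _ = s * ?Y * (?Z * (s * A * ?W) * 1) =>
        replace (s * Y * (Z * (s * A * W) * 1))
          with ((s * s) * (Y * Z * A * W)) by ring end.
      rewrite Hs. field. repeat split; try assumption; lra. }
  (* The central term accounts for the loss of 1 / (m + 1) in [H p - H (S m)]. *)
  assert (Hmid : w ^ p / INR (S m) = c * f p).
  { unfold c, f, beta_coef. fold (binom (p + S m) p).
    rewrite binom_fact_l, pow1, pow_opp.
    replace (p + 1 + m)%nat with (p + S m)%nat by lia.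
    rewrite !INR_fact_S, S_INR.
    pose proof (pos_INR m). pose proof (INR_fact_neq_0 m).
    pose proof (INR_fact_neq_0 p). pose proof (INR_fact_neq_0 (p + S m)).
    set (s := (-1) ^ p). assert (Hs : s * s = 1) by apply pow_m1_square.
    match goal with |- _ = s * ?Y * (?Z * (s * ?W) * 1) =>
      replace (s * Y * (Z * (s * W) * 1)) with ((s * s) * (Y * Z * W)) by ring end.
    rewrite Hs. field. repeat split; try assumption; lra. }
  unfold beta_closed. rewrite Hlow, Hhigh, H_S.
  rewrite !Rmult_plus_distr_l, <- Hmid. unfold Rdiv. ring.
Qed.

(** At m = 0 the upper sum is empty and the lower denominators reduce to j. What is left over after
    multiplying by [w] is the expansion of (w - 1)^(p + 1) divided by p + 1; its leading term w^(p +
    1) comes from the harmonic increment. *)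
Lemma beta_closed_S_l (p : nat) (w : R) :
  beta_closed (S p) 0 w = w * beta_closed p 0 w + (w - 1) ^ S p / INR (S p).
Proof.
  (* Cutting at the top index [S p] lists the expansion by descending powers of [w], as in the lower
     sum. *)
  pose proof (sum_f_R0_around
    (fun i => Binomial.C (S p) i * w ^ i * (-1) ^ (S p - i)) (S p) 0) as E.
  rewrite Nat.add_0_r, <- binomial, sum_n_m_empty in E.
  unfold Rminus. replace (- (1)) with (-1) by ring. rewrite E. clear E.
  unfold beta_closed. rewrite !sum_n_m_empty, H_S, H_0, !sum_n_m_last.
  pose proof (pos_INR p).
  fold (binom (S p) (S p)) (binom (S p) (S p - S p)).
  replace (S p - S p)%nat with 0%nat by lia.
  replace (S p - 0)%nat with (S p) by lia.
  (* Termwise this is C(p+1, j) / j = C(p, j) / j + C(p+1, j) / (p+1), that is, Pascal's rule with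
     C(p, j-1) / j = C(p+1, j) / (p+1). *)
  assert (Hs : sum_n_m (fun j => binom (S p) j
              * ((-1) ^ j * w ^ (S p - j) / (INR j * binom (0 + j) j))) 1 p
      = w * sum_n_m (fun j => binom p j
              * ((-1) ^ j * w ^ (p - j) / (INR j * binom (0 + j) j))) 1 p
        + / INR (S p) * sum_n_m (fun j => Binomial.C (S p) (S p - j)
              * w ^ (S p - j) * (-1) ^ (S p - (S p - j))) 1 p).
  { rewrite <- sum_n_m_lin. apply sum_n_m_ext_loc. intros j Hj.
    eq_in_R.
    destruct (Nat.le_exists_sub j p) as [q [-> _]]; [lia|].
    replace (S (q + j) - j)%nat with (S q) by lia.
    replace (S (q + j) - S q)%nat with j by lia.
    replace (q + j - j)%nat with q by lia.
    fold (binom (S (q + j)) (S q)).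
    change (S (q + j)) with (S q + j)%nat.
    rewrite binom_fact_l, !binom_fact_r, Nat.add_0_l.
    change (S q + j)%nat with (S (q + j)). rewrite S_INR, !INR_fact_S, plus_INR.
    assert (INR j <> 0) by (apply not_0_INR; lia).
    pose proof (pos_INR q). pose proof (pos_INR j).
    pose proof (INR_fact_neq_0 q). pose proof (INR_fact_neq_0 j).
    pose proof (INR_fact_neq_0 (q + j)).
    simpl (fact 0). simpl (INR 1). simpl (w ^ S q). field.
    repeat split; try assumption; lra. }
  rewrite Hs, Nat.add_0_l, !binom_diag, binom_0_r, S_INR. simpl (w ^ 0). simpl ((-1) ^ 0).
  rewrite <- (tech_pow_Rmult w p). unfold Rdiv.
  field. lra.
Qed.

(** * Summation of the Beta series *)

Lemma is_series_ln (z : R) (hz : 0 < z < 1) :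
  is_series (fun k => z ^ S k / INR (S k)) (- ln (1 - z)).
Proof.
  assert (Hgeom : forall t, 0 <= t < 1 -> is_series (fun k => 1 * t ^ k) (/ (1 - t))).
  { intros t Ht. apply is_series_ext with (fun k => t ^ k).
    - intros k. eq_in_R. ring.
    - apply is_series_geom. rewrite Rabs_pos_eq; lra. }
  (* The midpoint (1 + z) / 2 lies strictly above [z], and its powers are bounded by 1, so it bounds
     the radius from below. *)
  assert (Hr : Rbar_lt (Rabs z) (CV_radius (fun _ => 1))).
  { apply Rbar_lt_le_trans with ((1 + z) / 2).
    - simpl. rewrite Rabs_pos_eq; lra.
    - apply (proj1 (CV_radius_bounded (fun _ => 1))). exists 1. intros k.
      rewrite Rmult_1_l, <- RPow_abs, Rabs_pos_eq by lra.
      apply Rle_trans with (1 ^ k); [apply pow_incr; lra|rewrite pow1; lra]. }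
  (* The logarithmic series is the geometric series integrated from 0 to [z]; here the integral is
     evaluated in closed form. *)
  assert (HI : is_RInt (PSeries (fun _ => 1)) 0 z (- ln (1 - z))).
  { apply is_RInt_ext with (fun t => / (1 - t)).
    - rewrite Rmin_left, Rmax_right by lra. intros t Ht.
      symmetry. apply is_pseries_unique.
      apply is_pseries_R, Hgeom. lra.
    - replace (- ln (1 - z)) with (minus (- ln (1 - z)) (- ln (1 - 0))).
      + apply (is_RInt_derive (fun t => - ln (1 - t)));
          rewrite Rmin_left, Rmax_right by lra; intros t Ht.
        * auto_derive; [lra|field; lra].
        * apply (ex_derive_continuous (V := R_NormedModule) (fun t : R => / (1 - t))). auto_derive. lra.
      + rewrite Rminus_0_r, ln_1. unfold minus, plus, opp; simpl. ring. }
  pose proof (is_pseries_RInt (fun _ => 1) z Hr) as HS.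
  rewrite (is_RInt_unique _ _ _ _ HI) in HS. apply is_pseries_R in HS.
  apply is_series_ext with (fun k => PS_Int (fun _ => 1) (S k) * z ^ S k).
  { intros k. eq_in_R. unfold PS_Int, Rdiv. ring. }
  (* The integrated series has zero constant term, so shifting the index by one leaves the sum
     unchanged. *)
  apply (is_series_incr_1 (fun k => PS_Int (fun _ => 1) k * z ^ k)).
  simpl (PS_Int _ 0). rewrite Rmult_0_l.
  change (plus (- ln (1 - z)) 0) with (- ln (1 - z) + 0). now rewrite Rplus_0_r.
Qed.

(** By [beta_coef_S_l], the series for [S p] is [z] times the series for [p] minus the latter
    without its first term. Its sum is therefore z - 1 times the previous sum plus z^(p + 1) / (p +
    1), which is [beta_closed_S_l] at w = 1 - z with the sign (-1)^(p + 1). *)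
Lemma is_series_beta_0 (p : nat) (z : R) (hz : 0 < z < 1) :
  is_series (fun k => beta_coef p k * z ^ (p + S k)) ((-1) ^ p * beta_closed p 0 (1 - z)).
Proof.
  induction p as [|p IHp].
  - replace ((-1) ^ 0 * beta_closed 0 0 (1 - z)) with (- ln (1 - z)).
    + apply is_series_ext with (fun k => z ^ S k / INR (S k)).
      * intros k. eq_in_R. unfold beta_coef. change (0 + 1 + k)%nat with (S k). change (0 + S k)%nat with (S k).
        rewrite INR_fact_S, S_INR.
        pose proof (pos_INR k). pose proof (INR_fact_neq_0 k).
        simpl (fact 0). simpl (INR 1). field. repeat split; try assumption; lra.
      * now apply is_series_ln.
    + unfold beta_closed. rewrite !sum_n_m_empty. simpl. ring.
  - apply is_series_ext with (fun k => z * (beta_coef p k * z ^ (p + S k))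
        + - (beta_coef p (S k) * z ^ (p + S (S k)))).
    { intros k. eq_in_R. rewrite beta_coef_S_l.
      replace (S p + S k)%nat with (S (p + S k)) by lia.
      replace (p + S (S k))%nat with (S (p + S k)) by lia. simpl. ring. }
    replace ((-1) ^ S p * beta_closed (S p) 0 (1 - z))
      with (z * ((-1) ^ p * beta_closed p 0 (1 - z))
            + - ((-1) ^ p * beta_closed p 0 (1 - z) - beta_coef p 0 * z ^ (p + 1))).
    + apply (is_series_minus (V := R_NormedModule)).
      * now apply (is_series_scal (V := R_NormedModule)).
      * apply (is_series_incr_1 (fun k => beta_coef p k * z ^ (p + S k))).
        match goal with |- is_series _ ?l => replace l with ((-1) ^ p * beta_closed p 0 (1 - z)) end.
        -- exact IHp.
        -- change plus with Rplus. simpl. ring.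
    + rewrite beta_closed_S_l, beta_coef_0_r.
      replace (1 - z - 1) with (- z) by ring. rewrite (pow_opp z (S p)).
      replace (p + 1)%nat with (S p) by lia.
      assert (INR (S p) <> 0) by (apply not_0_INR; lia).
      pose proof (pow_m1_square p) as Hs. simpl ((-1) ^ S p).
      set (s := (-1) ^ p) in *.
      replace (-1 * s * ((1 - z) * beta_closed p 0 (1 - z) + -1 * s * z ^ S p / INR (S p)))
        with (- s * (1 - z) * beta_closed p 0 (1 - z) + (s * s) * z ^ S p / INR (S p))
        by (field; assumption).
      rewrite Hs. field. repeat split; try assumption; lra.
Qed.

Lemma is_series_beta (p m : nat) (z : R) (hz : 0 < z < 1) :
  is_series (fun k => beta_coef p (m + k) * z ^ (p + S (m + k)))
    ((-1) ^ p * beta_closed p m (1 - z)).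
Proof.
  induction m as [|m IHm].
  - now apply is_series_beta_0.
  - apply is_series_ext with (fun k => beta_coef p (m + S k) * z ^ (p + S (m + S k))).
    { intros k. now replace (m + S k)%nat with (S m + k)%nat by lia. }
    apply (is_series_incr_1 (fun k => beta_coef p (m + k) * z ^ (p + S (m + k)))).
    match goal with |- is_series _ ?l => replace l with ((-1) ^ p * beta_closed p m (1 - z)) end.
    + exact IHm.
    + change plus with Rplus. cbn beta. rewrite Nat.add_0_r.
      pose proof (beta_closed_S_r p m (1 - z)) as E.
      replace (1 - (1 - z)) with z in E by ring.
      pose proof (pow_m1_square p) as Hs. set (s := (-1) ^ p) in *.
      replace (beta_closed p (S m) (1 - z))
        with (beta_closed p m (1 - z) - s * beta_coef p m * z ^ (p + S m)) by lra.
      replace (s * (beta_closed p m (1 - z) - s * beta_coef p m * z ^ (p + S m)))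
        with (s * beta_closed p m (1 - z) - (s * s) * beta_coef p m * z ^ (p + S m)) by ring.
      rewrite Hs. ring.
Qed.

(** * Sequences that combine two powers *)

Lemma binom_neq_0 (n k : nat) : binom n k <> 0.
Proof.
  unfold binom, Binomial.C. apply Rmult_integral_contrapositive. split.
  - apply INR_fact_neq_0.
  - apply Rinv_neq_0_compat, Rmult_integral_contrapositive.
    split; apply INR_fact_neq_0.
Qed.

(** Since 1 - x = y and 1 - y = x, the arguments are exchanged: [c1], the coefficient of the powers
    of [x], multiplies the closed form at [y], and conversely. *)
Lemma is_series_two_powers (num : nat -> R) (l c1 c2 x y : R)
  (hl : l <> 0) (hx : 0 < x) (hy : 0 < y) (hxy : x + y = 1)
  (hnum : forall k, num k = l ^ k * (c1 * x ^ k + c2 * y ^ k)) (p m : nat) :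
  is_series (fun k => num (S p + (m + k))%nat
      / (l ^ (S p + (m + k)) * binom (S p + (m + k)) (m + k)))
    (INR (S p) * (-1) ^ p * (c1 * beta_closed p m y + c2 * beta_closed p m x)).
Proof.
  apply is_series_ext with (fun k =>
    INR (S p) * c1 * (beta_coef p (m + k) * x ^ (p + S (m + k)))
    + INR (S p) * c2 * (beta_coef p (m + k) * y ^ (p + S (m + k)))).
  { intros k. eq_in_R. rewrite hnum, beta_coef_binom, Nat.add_succ_r.
    change (S p + (m + k))%nat with (S (p + (m + k))).
    assert (INR (S p) <> 0) by (apply not_0_INR; lia).
    pose proof (binom_neq_0 (S (p + (m + k))) (m + k)).
    pose proof (pow_nonzero l (S (p + (m + k))) hl).
    field. repeat split; assumption. }
  match goal with |- is_series _ ?t => replace t with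
    (INR (S p) * c1 * ((-1) ^ p * beta_closed p m (1 - x))
     + INR (S p) * c2 * ((-1) ^ p * beta_closed p m (1 - y))) end.
  - apply (is_series_plus (V := R_NormedModule));
      apply (is_series_scal (V := R_NormedModule)); apply is_series_beta; lra.
  - replace (1 - x) with y by lra. replace (1 - y) with x by lra. ring.
Qed.

(** The left side has no logarithms, so adding [w ^ p * ln w] cancels the last term of
    [beta_closed]. Here, unlike in the series, [c1] stays with [x] and [c2] with [y]. *)
Lemma two_powers_closed (num : nat -> R) (l c1 c2 x y : R) (hl : l <> 0)
  (hnum : forall k, num k = l ^ k * (c1 * x ^ k + c2 * y ^ k)) (p m : nat) :
  sum_n_m (fun j => binom (S p - 1) j * ((-1) ^ j * num (S p - j - 1)%nat
      / (INR j * l ^ (S p - j - 1) * binom (m + j) j))) 1 (S p - 1)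
  - sum_n_m (fun j => binom m j * ((-1) ^ j * num (S p + j - 1)%nat
      / (INR j * l ^ (S p + j - 1) * binom (S p - 1 + j) j))) 1 m
  + num (S p - 1)%nat / l ^ (S p - 1) * (H (S p - 1) - H m)
  = c1 * (beta_closed p m x + x ^ p * ln x) + c2 * (beta_closed p m y + y ^ p * ln y).
Proof.
  replace (S p - 1)%nat with p by lia.
  unfold beta_closed.
  set (low := fun w j => binom p j
    * ((-1) ^ j * w ^ (p - j) / (INR j * binom (m + j) j))).
  set (high := fun w j => binom m j
    * ((-1) ^ j * w ^ (p + j) / (INR j * binom (p + j) j))).
  rewrite (sum_n_m_ext_loc _ (fun j => c1 * low x j + c2 * low y j) 1 p).
  2: { intros j Hj. eq_in_R.
       unfold low. replace (S p - j - 1)%nat with (p - j)%nat by lia. rewrite hnum.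
       assert (INR j <> 0) by (apply not_0_INR; lia).
       pose proof (binom_neq_0 (m + j) j). pose proof (pow_nonzero l (p - j) hl).
       field. repeat split; assumption. }
  rewrite (sum_n_m_ext_loc _ (fun j => c1 * high x j + c2 * high y j) 1 m).
  2: { intros j Hj. eq_in_R.
       unfold high. replace (S p + j - 1)%nat with (p + j)%nat by lia. rewrite hnum.
       assert (INR j <> 0) by (apply not_0_INR; lia).
       pose proof (binom_neq_0 (p + j) j). pose proof (pow_nonzero l (p + j) hl).
       field. repeat split; assumption. }
  rewrite !sum_n_m_lin, hnum. pose proof (pow_nonzero l p hl).
  fold (low x) (low y) (high x) (high y).
  field. assumption.
Qed.

(** * Binet formulas at even indices of either sign *)

Lemma sqrt5_sqr : sqrt 5 * sqrt 5 = 5.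
Proof. apply sqrt_sqrt. lra. Qed.

Lemma sqrt5_pos : 0 < sqrt 5.
Proof. apply sqrt_lt_R0. lra. Qed.

Lemma golden_pos : 0 < golden.
Proof. pose proof sqrt5_pos. unfold golden. lra. Qed.

Lemma golden_sqr : golden * golden = golden + 1.
Proof. pose proof sqrt5_sqr. unfold golden. lra. Qed.

Lemma fib_nat_binet (n : nat) :
  IZR (fib_nat n) = (golden ^ n - (1 - golden) ^ n) / sqrt 5.
Proof.
  pose proof sqrt5_pos. pose proof golden_sqr as Hg.
  enough (E : IZR (fib_nat n) = (golden ^ n - (1 - golden) ^ n) / sqrt 5
    /\ IZR (fib_nat (S n)) = (golden ^ S n - (1 - golden) ^ S n) / sqrt 5)
    by apply E.
  induction n as [|n [IH1 IH2]].
  - split; unfold golden; simpl; field; lra.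
  - split; [exact IH2|].
    change (fib_nat (S (S n))) with (fib_nat (S n) + fib_nat n)%Z.
    rewrite plus_IZR, IH1, IH2. simpl.
    replace (golden * (golden * golden ^ n)) with ((golden + 1) * golden ^ n)
      by (rewrite <- Hg; ring).
    (* The conjugate root satisfies the same quadratic: (1 - golden)^2 = 2 - golden = (1 - golden) +
       1. *)
    replace ((1 - golden) * ((1 - golden) * (1 - golden) ^ n))
      with ((2 - golden) * (1 - golden) ^ n)
      by (replace (2 - golden) with (1 - 2 * golden + (golden + 1)) by ring;
          rewrite <- Hg; ring).
    field. lra.
Qed.

Lemma lucas_nat_binet (n : nat) :
  IZR (lucas_nat n) = golden ^ n + (1 - golden) ^ n.
Proof.
  pose proof golden_sqr as Hg.
  enough (E : IZR (lucas_nat n) = golden ^ n + (1 - golden) ^ n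
    /\ IZR (lucas_nat (S n)) = golden ^ S n + (1 - golden) ^ S n)
    by apply E.
  induction n as [|n [IH1 IH2]].
  - split; simpl; ring.
  - split; [exact IH2|].
    change (lucas_nat (S (S n))) with (lucas_nat (S n) + lucas_nat n)%Z.
    rewrite plus_IZR, IH1, IH2. simpl.
    replace (golden * (golden * golden ^ n)) with ((golden + 1) * golden ^ n)
      by (rewrite <- Hg; ring).
    replace ((1 - golden) * ((1 - golden) * (1 - golden) ^ n))
      with ((2 - golden) * (1 - golden) ^ n)
      by (replace (2 - golden) with (1 - 2 * golden + (golden + 1)) by ring;
          rewrite <- Hg; ring).
    ring.
Qed.

(** The conjugate root is the negative of [/ golden], and an even exponent absorbs the sign. *)
Lemma golden_conj_pow_even (k : nat) : (1 - golden) ^ (2 * k) = / golden ^ (2 * k).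
Proof.
  pose proof golden_pos. rewrite <- pow_inv, !pow_mult. f_equal.
  replace (/ golden) with (golden - 1).
  - ring.
  - apply Rmult_eq_reg_l with golden; [|lra].
    rewrite Rinv_r by lra. pose proof golden_sqr. lra.
Qed.

(** The bound 0 < k makes the second case strictly negative, which selects the second branch of
    [fib] and [lucas]. *)
Lemma even_cases (r : Z) (hr : Z.Even r) :
  exists k : nat, r = Z.of_nat (2 * k) \/ r = (- Z.of_nat (2 * k))%Z /\ (0 < k)%nat.
Proof.
  destruct hr as [s ->]. exists (Z.abs_nat s). lia.
Qed.

Lemma F_even (r : Z) (hr : Z.Even r) :
  F r = (powerRZ golden r - powerRZ golden (- r)) / sqrt 5.
Proof.
  pose proof sqrt5_pos.
  assert (E : forall k, IZR (fib_nat (2 * k))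
      = (golden ^ (2 * k) - / golden ^ (2 * k)) / sqrt 5).
  { intros k. now rewrite fib_nat_binet, golden_conj_pow_even. }
  destruct (even_cases r hr) as [k [-> | [-> Hk]]]; unfold F, fib.
  - rewrite (proj2 (Z.leb_le 0 (Z.of_nat (2 * k)))) by lia.
    now rewrite Nat2Z.id, E, powerRZ_neg', <- pow_powerRZ.
  - rewrite (proj2 (Z.leb_gt 0 (- Z.of_nat (2 * k)))) by lia.
    rewrite Z.opp_involutive, Nat2Z.id, powerRZ_neg', <- pow_powerRZ.
    (* The exponent 2k - 1 = 2(k - 1) + 1 is odd, and the resulting minus sign exchanges the two
       powers of [golden]. *)
    change (-1)%Z with (- (1))%Z. rewrite Z.pow_opp_odd, Z.pow_1_l.
    + rewrite mult_IZR, opp_IZR, E. field.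
      split; [apply pow_nonzero; pose proof golden_pos|]; lra.
    + lia.
    + exists (Z.of_nat k - 1)%Z. lia.
Qed.

Lemma L_even (r : Z) (hr : Z.Even r) :
  L r = powerRZ golden r + powerRZ golden (- r).
Proof.
  assert (E : forall k, IZR (lucas_nat (2 * k)) = golden ^ (2 * k) + / golden ^ (2 * k)).
  { intros k. now rewrite lucas_nat_binet, golden_conj_pow_even. }
  destruct (even_cases r hr) as [k [-> | [-> Hk]]]; unfold L, lucas.
  - rewrite (proj2 (Z.leb_le 0 (Z.of_nat (2 * k)))) by lia.
    now rewrite Nat2Z.id, E, powerRZ_neg', <- pow_powerRZ.
  - rewrite (proj2 (Z.leb_gt 0 (- Z.of_nat (2 * k)))) by lia.
    rewrite Z.opp_involutive, Nat2Z.id, powerRZ_neg', <- pow_powerRZ.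
    change (-1)%Z with (- (1))%Z. rewrite Z.pow_opp_even, Z.pow_1_l.
    + rewrite Z.mul_1_l, E. ring.
    + lia.
    + exists (Z.of_nat k). lia.
Qed.

(** * Integer powers of the golden ratio and assembly of the two identities *)

Lemma powerRZ_mul_nat (x : R) (z : Z) (k : nat) (hx : 0 < x) :
  powerRZ x (z * Z.of_nat k) = powerRZ x z ^ k.
Proof.
  rewrite !powerRZ_Rpower by assumption.
  rewrite <- Rpower_pow by apply exp_pos.
  now rewrite Rpower_mult, mult_IZR, <- INR_IZR_INZ.
Qed.

Lemma ln_powerRZ (x : R) (z : Z) (hx : 0 < x) : ln (powerRZ x z) = IZR z * ln x.
Proof. rewrite powerRZ_Rpower by assumption. apply ln_exp. Qed.

Theorem theorem9 (r : Z) (n m : nat) (hr : Z.Even r) (hn : (0 < n)%nat) :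
  (ex_series (fun k : nat =>
      let j := (m + k)%nat in
      F (r * Z.of_nat (n + j)) / (L r ^ (n + j) * binom (n + j) j))
   /\
   (-1) ^ n / INR n
     * Series (fun k : nat =>
         let j := (m + k)%nat in
         F (r * Z.of_nat (n + j)) / (L r ^ (n + j) * binom (n + j) j))
   = sum_n_m (fun j : nat =>
         binom (n - 1) j
         * ((-1) ^ j * F (r * Z.of_nat (n - j - 1))
            / (INR j * L r ^ (n - j - 1) * binom (m + j) j))) 1 (n - 1)
     - sum_n_m (fun j : nat =>
         binom m j
         * ((-1) ^ j * F (r * Z.of_nat (n + j - 1))
            / (INR j * L r ^ (n + j - 1) * binom (n - 1 + j) j))) 1 m
     + F (r * Z.of_nat (n - 1)) / L r ^ (n - 1) * (H (n - 1) - H m)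
     + 1 / L r ^ (n - 1)
       * (F (r * Z.of_nat (n - 1)) * ln (L r)
          - IZR r * L (r * Z.of_nat (n - 1)) / sqrt 5 * ln golden))
  /\
  (ex_series (fun k : nat =>
      let j := (m + k)%nat in
      L (r * Z.of_nat (n + j)) / (L r ^ (n + j) * binom (n + j) j))
   /\
   (-1) ^ (n - 1) / INR n
     * Series (fun k : nat =>
         let j := (m + k)%nat in
         L (r * Z.of_nat (n + j)) / (L r ^ (n + j) * binom (n + j) j))
   = sum_n_m (fun j : nat =>
         binom (n - 1) j
         * ((-1) ^ j * L (r * Z.of_nat (n - j - 1))
            / (INR j * L r ^ (n - j - 1) * binom (m + j) j))) 1 (n - 1)
     - sum_n_m (fun j : nat =>
         binom m j
         * ((-1) ^ j * L (r * Z.of_nat (n + j - 1))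
            / (INR j * L r ^ (n + j - 1) * binom (n - 1 + j) j))) 1 m
     + L (r * Z.of_nat (n - 1)) / L r ^ (n - 1) * (H (n - 1) - H m)
     + 1 / L r ^ (n - 1)
       * (L (r * Z.of_nat (n - 1)) * ln (L r)
          - IZR r * F (r * Z.of_nat (n - 1)) * sqrt 5 * ln golden)).
Proof.
  destruct n as [|p]; [lia|]. cbv zeta.
  pose proof golden_pos as Hg. pose proof sqrt5_pos as H5.
  set (a := powerRZ golden r). set (b := powerRZ golden (- r)).
  assert (Ha : 0 < a) by (apply powerRZ_lt; exact Hg).
  assert (Hb : 0 < b) by (apply powerRZ_lt; exact Hg).
  assert (HL : L r = a + b) by (apply L_even; exact hr).
  assert (Hl : L r <> 0) by lra.
  assert (Hev : forall k, Z.Even (r * Z.of_nat k)).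
  { intros k. destruct hr as [s ->]. exists (s * Z.of_nat k)%Z. ring. }
  set (x := a / L r). set (y := b / L r).
  assert (Hx : 0 < x) by (apply Rdiv_lt_0_compat; lra).
  assert (Hy : 0 < y) by (apply Rdiv_lt_0_compat; lra).
  assert (Hxy : x + y = 1) by (unfold x, y; rewrite HL; field; lra).
  assert (Hxk : forall k, powerRZ golden (r * Z.of_nat k) = L r ^ k * x ^ k).
  { intros k. rewrite powerRZ_mul_nat, <- Rpow_mult_distr by exact Hg.
    fold a. f_equal. unfold x. field. exact Hl. }
  assert (Hyk : forall k, powerRZ golden (- (r * Z.of_nat k)) = L r ^ k * y ^ k).
  { intros k. rewrite <- Z.mul_opp_l, powerRZ_mul_nat, <- Rpow_mult_distr by exact Hg.
    fold b. f_equal. unfold y. field. exact Hl. }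
  assert (HFk : forall k, F (r * Z.of_nat k)
      = L r ^ k * (/ sqrt 5 * x ^ k + - / sqrt 5 * y ^ k)).
  { intros k. rewrite F_even, Hxk, Hyk by apply Hev. field. lra. }
  assert (HLk : forall k, L (r * Z.of_nat k) = L r ^ k * (1 * x ^ k + 1 * y ^ k)).
  { intros k. rewrite L_even, Hxk, Hyk by apply Hev. ring. }
  (* The multiples of [ln golden] in [ln x] and [ln y] are opposite. This turns the Fibonacci
     combination of powers into the Lucas one, and conversely, in the last term of each identity. *)
  assert (Hlnx : ln x = IZR r * ln golden - ln (L r)).
  { unfold x. rewrite ln_div by lra. unfold a. now rewrite ln_powerRZ. }
  assert (Hlny : ln y = - IZR r * ln golden - ln (L r)).
  { unfold y. rewrite ln_div by lra. unfold b. now rewrite ln_powerRZ, opp_IZR. }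
  pose proof (pow_nonzero (L r) p Hl) as Hlp.
  pose proof (pow_m1_square p) as Hs.
  assert (Hp : INR (S p) <> 0) by (apply not_0_INR; lia).
  pose proof (is_series_two_powers (fun k => F (r * Z.of_nat k)) (L r) _ _ x y
    Hl Hx Hy Hxy HFk p m) as SF.
  pose proof (is_series_two_powers (fun k => L (r * Z.of_nat k)) (L r) _ _ x y
    Hl Hx Hy Hxy HLk p m) as SL.
  split; split.
  - eexists. exact SF.
  - rewrite (is_series_unique _ _ SF).
    rewrite (two_powers_closed (fun k => F (r * Z.of_nat k)) (L r) _ _ x y Hl HFk).
    replace (S p - 1)%nat with p by lia. rewrite HFk, HLk, Hlnx, Hlny.
    simpl ((-1) ^ S p). set (s := (-1) ^ p) in *.
    (* Exchanging [x] and [y] negates the Fibonacci combination, whose coefficients are opposite;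
       the sign (-1)^n = -(-1)^p compensates. *)
    match goal with |- -1 * s / ?i * (?i * s * ?t) = _ =>
      replace (-1 * s / i * (i * s * t)) with (- ((s * s) * t))
        by (generalize t; intros u; field; exact Hp) end.
    rewrite Hs. field. split; try exact Hlp; lra.
  - eexists. exact SL.
  - rewrite (is_series_unique _ _ SL).
    rewrite (two_powers_closed (fun k => L (r * Z.of_nat k)) (L r) _ _ x y Hl HLk).
    replace (S p - 1)%nat with p by lia. rewrite HFk, HLk, Hlnx, Hlny.
    set (s := (-1) ^ p) in *.
    (* The Lucas combination is symmetric in [x] and [y], which is why its prefactor is (-1)^(n -
       1). *)
    match goal with |- s / ?i * (?i * s * ?t) = _ =>
      replace (s / i * (i * s * t)) with ((s * s) * t)
        by (generalize t; intros u; field; exact Hp) end.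
    rewrite Hs. field. split; try exact Hlp; lra.
Qed.
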